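(* (i) For any odd integer $n>1$, we have $$t_n:=\frac1{\sqrt n}\operatorname{per}\left[\tan\pi\frac{jk}{n}\right]_{1\le j,k\le (n-1)/2}\in\mathbb Z.$$ (ii) For any odd prime $p$, we have $$t_p':=\sqrt p\,\operatorname{per}\left[\cot\pi\frac{jk}{p}\right]_{1\le j,k\le (p-1)/2}\in\mathbb Z.$$ (iii) Let $p$ be any odd prime. Then $$t_p\equiv(-1)^{(p+1)/2}\pmod p\quad\text{and}\quad t_p'\equiv1\pmod p.$$
   Context: The permanent of an $N\times N$ matrix $A=[a_{j,k}]$ is $\operatorname{per}(A)=\sum_{\tau\in S_N}\prod_{j=1}^{N}a_{j,\tau(j)}$. $\tan\pi\frac{m}{n}$ means $\tan(\pi m/n)$, and similarly for $\cot=1/\tan$. *)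

(* Defs.v *)
From mathcomp Require Import all_boot all_order all_algebra all_fingroup.
From mathcomp Require Import reals trigo.

Set Implicit Arguments.
Unset Strict Implicit.
Unset Printing Implicit Defensive.

Import Order.TTheory GRing.Theory Num.Theory.
Local Open Scope ring_scope.

Definition permanent (R : comNzRingType) (N : nat) (A : 'M[R]_N) : R :=
  \sum_(s : 'S_N) \prod_(j < N) A j (s j).

Definition cot (R : realType) (x : R) : R := (tan x)^-1.

(* Ordinals start at 0, so rows and columns j, k in 1..(n-1)/2 are encoded by
   j.+1 and k.+1 with j, k < (n-1)/2. *)
Definition tan_mx (R : realType) (n : nat) : 'M[R]_((n - 1) %/ 2) :=
  \matrix_(j, k) tan (pi * (j.+1 * k.+1)%:R / n%:R).

Definition cot_mx (R : realType) (n : nat) : 'M[R]_((n - 1) %/ 2) :=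
  \matrix_(j, k) cot (pi * (j.+1 * k.+1)%:R / n%:R).

Definition tan_per (R : realType) (n : nat) : R :=
  (Num.sqrt n%:R)^-1 * permanent (tan_mx R n).

Definition cot_per (R : realType) (n : nat) : R :=
  Num.sqrt n%:R * permanent (cot_mx R n).

Arguments tan_per R n : clear implicits.
Arguments cot_per R n : clear implicits.

(* Main.v *)
Require Import Defs.
From mathcomp Require Import all_boot all_order all_algebra all_fingroup.
From mathcomp Require Import all_solvable all_field.
From mathcomp Require Import reals trigo.
From mathcomp Require Import complex.
From mathcomp Require Import zify ring lra.
Import Order.TTheory GRing.Theory Num.Theory.
Local Open Scope ring_scope.

(** Let [n = 2N + 1] and [z = exp (2 pi i / n)]. Since
    [sqrt n = prod_(1 <= j <= N) 2 sin (2 pi j / n)] ([prod_2sin]), the numbers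
    [t_n] and [t'_p] are themselves permanents, with entries
    [tan (pi j k / n) / (2 sin (2 pi j / n))] and
    [2 sin (2 pi j / p) cot (pi j k / p)]. With [y = z ^ j] these entries are
    [((y^k - 1) / (y^k + 1)) / (y - 1/y)] and
    [(y - 1/y) (y^k + 1) / (y^k - 1)]. Two things happen at once.

    The entries are values at [y] of polynomials with integer coefficients
    ([tan_poly] and [cot_poly]): for an odd [n], [1 + y^k] is invertible in
    [Z[y]] unless [y^k = 1], when the numerator [y^k - 1] vanishes; and
    [(y^k - 1) / (y - 1)] is a geometric sum, as is its inverse when [k] is
    invertible modulo [n]. So each permanent is [F(z)] for some [F] in [Z[X]].

    The entries do not change when [y] becomes [1/y], for they are quotients of
    two odd functions. Replacing [z] by [z^c], with [c] coprime to [n], sends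
    row [j] to the row of the representative of [c j] or [- c j] in [1..N]: it
    permutes the rows ([half_system_perm]), so that [F(z^c) = F(z)].

    Reduce [F] modulo the cyclotomic polynomial [Phi_n]. The remainder [r] lies
    in [Z[X]], has degree less than [phi(n)] and takes the same value at the
    [phi(n)] primitive roots of unity; so it is a constant integer, which is
    [F(z)] ([int_poly_invariant]). If [n = p] is prime, then [Phi_p(1) = p] gives
    also [F(z) = F(1)] modulo [p]. At [X = 1] all the rows are equal, hence
    [F(1)] is [N!] times the product of the entries of a row. For the tangent
    this is [N!^2 ((p+1)/2)^(p-1)], and Wilson's theorem gives
    [N!^2 = (-1)^(N+1)]; for the cotangent it is [4^N = 2^(p-1)], up to factors
    that cancel modulo [p]; Fermat's little theorem concludes. *)

(** * Permanents *)

Lemma permanent_row_perm {R : comNzRingType} {N : nat} (s : 'S_N) (A : 'M[R]_N) :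
  permanent (row_perm s A) = permanent A.
Proof.
rewrite /permanent (reindex_inj (mulgI s)) /=; apply: eq_bigr => u _.
rewrite [RHS](reindex_inj (@perm_inj _ s)) /=; apply: eq_bigr => j _.
by rewrite mxE permM.
Qed.

Lemma permanent_row_scale {R : comNzRingType} {N : nat} (a : 'I_N -> R) (A : 'M[R]_N) :
  permanent (\matrix_(j, k) (a j * A j k)) = (\prod_j a j) * permanent A.
Proof.
rewrite /permanent mulr_sumr; apply: eq_bigr => s _.
by rewrite -big_split; apply: eq_bigr => j _; rewrite mxE.
Qed.

Lemma permanent_map {R S : comNzRingType} (f : {rmorphism R -> S}) {N : nat}
    (A : 'M[R]_N) : f (permanent A) = permanent (map_mx f A).
Proof.
rewrite rmorph_sum; apply: eq_bigr => s _.
by rewrite rmorph_prod; apply: eq_bigr => j _; rewrite mxE.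
Qed.

Lemma permanent_const_rows {R : comNzRingType} {N : nat} (b : 'I_N -> R) :
  permanent (\matrix_(j < N, k < N) b k) = N`!%:R * \prod_k b k.
Proof.
have rowE (s : 'S_N) : \prod_j (\matrix_(j < N, k < N) b k) j (s j) = \prod_k b k.
  rewrite [RHS](reindex_inj (@perm_inj _ s)).
  by apply: eq_bigr => j _; rewrite mxE.
rewrite /permanent (eq_bigr _ (fun s _ => rowE s)).
by rewrite sumr_const card_Sn mulr_natl.
Qed.

(** * Integer polynomials at roots of unity *)

Lemma sum_Xn_eval1 {R : nzSemiRingType} (n : nat) (f : nat -> nat) :
  (\sum_(i < n) 'X^(f i) : {poly R}).[1] = n%:R.
Proof.
rewrite horner_sum (eq_bigr (fun=> 1)) => [|i _]; last by rewrite hornerXn expr1n.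
by rewrite sumr_const card_ord.
Qed.

(** From [z^n = 1], some [Phi_d] with [d] dividing [n] vanishes at [z]; as it
    divides [X^d - 1], the order [n] of [z] divides [d]. *)
Lemma root_Cyclotomic_prim {K : fieldType} {n : nat} {z : K} :
  n.-primitive_root z -> root (map_poly intr 'Phi_n) z.
Proof.
move=> zP; have n_gt0 := prim_order_gt0 zP.
have evalX d : (0 < d)%N ->
    \prod_(e <- divisors d) (map_poly intr 'Phi_e).[z] = z ^+ d - 1.
  move=> d_gt0; rewrite -horner_prod -rmorph_prod prod_Cyclotomic //.
  by rewrite rmorphB rmorph1 /= map_polyXn !hornerE.
have /eqP : \prod_(e <- divisors n) (map_poly intr 'Phi_e).[z] = 0.
  by rewrite evalX // prim_expr_order // subrr.
rewrite prodf_seq_eq0 => /hasP [d]; rewrite -dvdn_divisors // => d_dvd.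
have d_gt0 := dvdn_gt0 n_gt0 d_dvd.
rewrite andTb => Phi_d0; suff n_dvd : (n %| d)%N.
  by move: Phi_d0; rewrite (eqP (_ : d == n)) // eqn_dvd d_dvd.
rewrite (prim_order_dvd zP) -subr_eq0 -evalX // prodf_seq_eq0.
by apply/hasP; exists d; rewrite ?divisors_id.
Qed.

Lemma Cyclotomic_prime_eval1 {p : nat} : prime p -> ('Phi_p).[1] = p%:R.
Proof.
move=> p_pr; have p_gt0 := prime_gt0 p_pr.
have Phi1 : 'Phi_1 = 'X - 1.
  by have := prod_Cyclotomic (ltn0Sn 0); rewrite big_seq1.
have := prod_Cyclotomic p_gt0.
have divp : perm_eq (divisors p) [:: 1%N; p].
  apply: uniq_perm; rewrite ?divisors_uniq //=.
    by rewrite inE eq_sym neq_ltn prime_gt1 ?orbT.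
  move=> d; rewrite -dvdn_divisors // !inE; apply/idP/idP.
    by case/primeP: p_pr => _; apply.
  by case/orP => /eqP ->; rewrite ?dvd1n ?dvdnn.
rewrite (perm_big _ divp) big_cons big_seq1 Phi1 subrX1.
move/(mulfI (_ : 'X - 1 != 0)) => -> //; last by rewrite polyXsubC_eq0.
exact: (sum_Xn_eval1 _ id).
Qed.

(** This plays the role of Galois theory: an element of [Z[z]] that is fixed by
    all the substitutions of [z^c] for [z] is an integer. The remainder of [F]
    modulo [Phi_n] minus the common value has [phi(n)] roots, more than its
    degree allows, so the remainder is constant, and an
    integer because the division takes place in [Z[X]]. The congruence is the identity
    [F = Q Phi_n + t] at [1], where [Phi_p(1) = p]. *)
Lemma int_poly_invariant {K : numFieldType} {n : nat} {z : K} (F : {poly int}) :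
  n.-primitive_root z ->
  (forall c, coprime c n -> (map_poly intr F).[z ^+ c] = (map_poly intr F).[z]) ->
  exists2 t : int, (map_poly intr F).[z] = t%:~R
    & prime n -> (n %| t - F.[1])%Z.
Proof.
move=> zP invF; have n_gt0 := prim_order_gt0 zP.
have Phi_mon := Cyclotomic_monic n.
pose Q := Pdiv.Ring.rdivp F 'Phi_n; pose r := Pdiv.Ring.rmodp F 'Phi_n.
have FE : F = Q * 'Phi_n + r by exact: Pdiv.RingMonic.rdivp_eq.
have evalF c : coprime c n -> (map_poly intr F).[z ^+ c] = (map_poly intr r).[z ^+ c].
  move=> co; rewrite {1}FE rmorphD rmorphM /= !hornerE.
  have /rootP -> : root (map_poly intr 'Phi_n) (z ^+ c).
    by apply: root_Cyclotomic_prim; rewrite prim_root_exp_coprime.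
  by rewrite mulr0 add0r.
have size_r : (size r <= totient n)%N.
  by rewrite -ltnS -size_Cyclotomic Pdiv.Ring.ltn_rmodpN0 // monic_neq0.
set w := (map_poly intr F).[z].
have rC : map_poly intr r = w%:P.
  apply/eqP; rewrite -subr_eq0; apply/negPn/negP => nz.
  pose rs := [seq z ^+ (val k) | k <- enum 'I_n & coprime (val k) n].
  have uniq_rs : uniq rs.
    rewrite map_inj_in_uniq ?(filter_uniq _ (enum_uniq _)) // => i j _ _ /eqP.
    by rewrite (eq_prim_root_expr zP) !modn_small ?ltn_ord // => /eqP/val_inj.
  have root_rs : all (root (map_poly intr r - w%:P)) rs.
    apply/allP => x /mapP [k k_in ->]; move: k_in; rewrite mem_filter => /andP [co _].
    by rewrite rootE !hornerE -evalF // invF // subrr.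
  have := max_poly_roots nz root_rs uniq_rs.
  have -> : size rs = totient n.
    rewrite size_map size_filter totient_count_coprime big_mkord -sum1_count.
    rewrite big_mkcond big_enum /=; apply: eq_bigr => i _.
    by rewrite coprime_sym; case: coprime.
  rewrite ltnNge => /negP; apply; apply: leq_trans (size_polyD _ _) _.
  rewrite size_polyN geq_max (leq_trans (size_poly _ _) size_r).
  by rewrite (leq_trans (size_polyC_leq1 _)) // totient_gt0.
have wE : w = (r`_0)%:~R.
  by have := congr1 (fun q : {poly K} => q`_0) rC; rewrite coef_map coefC.
have rC0 : r = (r`_0)%:P.
  apply: (map_inj_poly (@intr_inj K)); rewrite ?mulr0z //.
  by rewrite rC wE map_polyC.
exists r`_0 => //.
move=> n_pr; rewrite FE !hornerE (Cyclotomic_prime_eval1 n_pr).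
rewrite [in r.[1]]rC0 hornerC opprD addrCA subrr addr0.
by rewrite rpredN natz dvdz_mull.
Qed.

(** * Row permutations in a half system *)

(** The Gauss lemma setting: each [c j] is congruent, up to sign, to exactly one
    element of the half system [1..N]. The signs are not recorded, because the
    entries of the matrices are even functions of the root of unity. If [c i]
    and [c j] had the same representative, then [n] would divide [i - j] or
    [i + j], and [0 < i + j < n]. *)
Lemma half_system_perm {N c : nat} : coprime c N.*2.+1 ->
  exists s : 'S_N, forall j : 'I_N,
    c * j.+1 = (s j).+1 %[mod N.*2.+1] \/ (N.*2.+1 %| c * j.+1 + (s j).+1)%N.
Proof.
set n := N.*2.+1 => co.
have [j|f fP] := @fin_all_exists _ (fun=> 'I_N) (fun (j k : 'I_N) =>
  c * j.+1 = k.+1 %[mod n] \/ (n %| c * j.+1 + k.+1)%N).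
  have r_gt0 : (0 < (c * j.+1) %% n)%N.
    rewrite lt0n -/(n %| _)%N Gauss_dvdr; last by rewrite coprime_sym.
    by apply/negP => /dvdn_leq; have := ltn_ord j; lia.
  have r_lt : ((c * j.+1) %% n < n)%N by rewrite ltn_mod.
  have rE := divn_eq (c * j.+1) n.
  have [r_le|r_gt] := leqP ((c * j.+1) %% n) N.
    have lt : (((c * j.+1) %% n).-1 < N)%N by lia.
    by exists (Ordinal lt); left; rewrite /= prednK // modn_mod.
  have lt : ((n - (c * j.+1) %% n).-1 < N)%N by lia.
  exists (Ordinal lt); right; rewrite /= prednK; last by lia.
  apply/dvdnP; exists ((c * j.+1) %/ n).+1; lia.
have f_inj : injective f.
  move=> i j fij; apply: val_inj => /=.
  have n_co : coprimez n c.
    by rewrite /coprimez -[gcdz _ _]/((gcdn n c)%:Z) eqz_nat -/(coprime n c) coprime_sym.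
  have toZ (k : 'I_N) :
      (n %| c%:Z * k.+1%:Z - (f k).+1%:Z)%Z \/ (n %| c%:Z * k.+1%:Z + (f k).+1%:Z)%Z.
    case: (fP k) => h; [left|right].
      by rewrite -eqz_mod_dvd -PoszM !modz_nat h.
    by rewrite -PoszM -PoszD.
  have : (n %| i.+1%:Z - j.+1%:Z)%Z \/ (n %| i.+1%:Z + j.+1%:Z)%Z.
    have := toZ i; have := toZ j; rewrite fij => toZj toZi.
    rewrite -(Gauss_dvdzr (_ - _) n_co) -(Gauss_dvdzr (_ + _) n_co).
    set ci := c%:Z * i.+1%:Z in toZi *; set cj := c%:Z * j.+1%:Z in toZj *.
    set b := (f j).+1%:Z in toZi toZj.
    rewrite mulrBr mulrDr -/ci -/cj.
    clearbody ci cj b; case: toZi toZj => hi [] hj; [left|right|right|left].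
    - by have -> : ci - cj = (ci - b) - (cj - b); [ring | exact: rpredB].
    - by have -> : ci + cj = (ci - b) + (cj + b); [ring | exact: rpredD].
    - by have -> : ci + cj = (ci + b) + (cj - b); [ring | exact: rpredD].
    - by have -> : ci - cj = (ci + b) - (cj + b); [ring | exact: rpredB].
  have := ltn_ord i; have := ltn_ord j; rewrite -PoszD.
  move=> jN iN [] /dvdn_leq; last by lia.
  by lia.
by exists (perm f_inj) => j; rewrite permE.
Qed.

Lemma unity_root_neq0 {K : fieldType} {m : nat} {y : K} : y ^+ m.+1 = 1 -> y != 0.
Proof. by apply: contra_eq_neq => ->; rewrite expr0n eq_sym oner_eq0. Qed.

(** The common core of the two cases: row [j] holds the values at [z ^ j] of
    polynomials that do not distinguish [y] from [1/y]. The polynomial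
    [F = per (g_k(X^j))] then satisfies the hypothesis of
    [int_poly_invariant], because [F(z^c)] has the rows of [F(z)] permuted. *)
Lemma even_permanent_int {K : numFieldType} {N : nat} {z : K}
    (g : 'I_N -> {poly int}) :
  N.*2.+1.-primitive_root z ->
  (forall k (y : K), y ^+ N.*2.+1 = 1 -> y != 1 ->
     (map_poly intr (g k)).[y^-1] = (map_poly intr (g k)).[y]) ->
  exists2 t : int,
    permanent (\matrix_(j < N, k < N) (map_poly intr (g k)).[z ^+ j.+1]) = t%:~R
    & prime N.*2.+1 ->
      (N.*2.+1 %| t - N`!%:R * \prod_k (g k).[1])%Z.
Proof.
move=> zP g_even; set n := N.*2.+1 in zP g_even *.
pose F : {poly int} := permanent (\matrix_(j < N, k < N) (g k \Po 'X^(j.+1))).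
have evalF (x : K) : (map_poly intr F).[x] =
    permanent (\matrix_(j < N, k < N) (map_poly intr (g k)).[x ^+ j.+1]).
  rewrite (permanent_map (map_poly intr)) -[LHS]/(horner_eval x _) permanent_map.
  congr permanent; apply/matrixP => j k; rewrite !mxE /=.
  by rewrite map_comp_poly /horner_eval horner_comp map_polyXn hornerXn.
have F1 : F.[1] = N`!%:R * \prod_k (g k).[1].
  rewrite -[LHS]/(horner_eval 1 _) permanent_map -permanent_const_rows.
  congr permanent; apply/matrixP => j k; rewrite !mxE /=.
  by rewrite /horner_eval horner_comp hornerXn expr1n.
rewrite -F1 -evalF; apply: (int_poly_invariant _ zP) => c co.
rewrite !evalF; have [s sP] := half_system_perm co.
rewrite -[RHS](permanent_row_perm s); congr permanent.
apply/matrixP => j k; rewrite !mxE -exprM.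
case: (sP j) => [/eqP|]; rewrite -/n.
  by rewrite -(eq_prim_root_expr zP) => /eqP ->.
rewrite (prim_order_dvd zP) exprD => /eqP inv.
have zu : z ^+ (s j).+1 != 0.
  by rewrite expf_neq0 // (unity_root_neq0 (prim_expr_order zP)).
rewrite -[z ^+ (c * _)](mulfK zu) inv mul1r g_even //.
  by rewrite exprAC (prim_expr_order zP) expr1n.
rewrite -(prim_order_dvd zP); apply/negP => /dvdn_leq.
by have := ltn_ord (s j); lia.
Qed.

(** * Polynomials for the tangent and the cotangent *)

(** At an [n]-th root of unity [y <> 1], with [n = 2N + 1], this is
    [(y^(n+1) - 1) / (y^2 - 1) = 1 / (y + 1)]. *)
Definition half_geom (N : nat) : {poly int} := \sum_(m < N.+1) 'X^(m.*2).

(** The factors after [X] stand for [(X^k - 1) / (X - 1)], [1 / (X + 1)] and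
    [1 / (X^k + 1)], and [X / (X^2 - 1) = 1 / (X - 1/X)]. *)
Definition tan_poly (N k : nat) : {poly int} :=
  'X * (\sum_(i < k) 'X^i) * half_geom N * (half_geom N \Po 'X^k).

(** Here [k'] is to be an inverse of [k] modulo [2N + 1], so that the last sum
    stands for [((X^k)^k' - 1) / (X^k - 1) = (X - 1) / (X^k - 1)]; the power
    [X^(2N)] stands for [1/X]. *)
Definition cot_poly (N k k' : nat) : {poly int} :=
  'X^(N.*2) * ('X + 1) * ('X^k + 1) * \sum_(i < k') 'X^(k * i).

Lemma half_geom1 N : (half_geom N).[1] = N.+1%:R.
Proof. exact: (sum_Xn_eval1 _ double). Qed.

Lemma tan_poly1 N k : (tan_poly N k).[1] = k%:R * N.+1%:R ^+ 2.
Proof.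
rewrite /tan_poly !hornerE horner_comp hornerXn expr1n half_geom1.
by rewrite (sum_Xn_eval1 _ id).
Qed.

Lemma cot_poly1 N k k' : (cot_poly N k k').[1] = 4 * k'%:R.
Proof.
by rewrite /cot_poly !hornerE !expr1n (sum_Xn_eval1 _ (muln k)); ring.
Qed.

Lemma odd_root_addr1_neq0 {K : numFieldType} {N : nat} {y : K} :
  y ^+ N.*2.+1 = 1 -> y + 1 != 0.
Proof.
move=> y_root; apply/negP => /eqP/addr0_eq yN1; move: y_root.
have -> : y = -1 by rewrite -yN1 opprK.
rewrite exprS -mul2n exprM sqrrN expr1n expr1n mulr1 => /eqP.
by rewrite eq_sym -subr_eq0 opprK -[1 + 1]/(2%:R) pnatr_eq0.
Qed.

(** The factor [y - 1] makes the formula hold at [y = 1] too, where [half_geom]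
    differs from [1 / (y + 1)]. This happens for [y ^ k] when [n] is not prime. *)
Lemma half_geomE {K : numFieldType} {N : nat} {y : K} :
  y ^+ N.*2.+1 = 1 ->
  (y - 1) * (map_poly intr (half_geom N)).[y] = (y - 1) / (y + 1).
Proof.
move=> y_root; have y1 := odd_root_addr1_neq0 y_root; apply: (mulIf y1); rewrite mulfVK //.
rewrite rmorph_sum horner_sum /= (eq_bigr (fun m : 'I_N.+1 => (y ^+ 2) ^+ m)).
  rewrite mulrAC -[X in X * _](_ : y ^+ 2 - 1 = _); last by ring.
  by rewrite -subrX1 -exprM mulnC muln2 doubleS exprS y_root mulr1.
by move=> m _; rewrite map_polyXn hornerXn -exprM mul2n.
Qed.

Lemma tan_polyE {K : numFieldType} {N : nat} (k : nat) {y : K} :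
  y ^+ N.*2.+1 = 1 -> y != 1 ->
  (map_poly intr (tan_poly N k)).[y] = (y ^+ k - 1) / (y ^+ k + 1) / (y - y^-1).
Proof.
move=> y_root y_neq1.
have yk_root : (y ^+ k) ^+ N.*2.+1 = 1 by rewrite exprAC y_root expr1n.
have y_neq0 := unity_root_neq0 y_root.
have yB1 : y - 1 != 0 by rewrite subr_eq0.
have yD1 := odd_root_addr1_neq0 y_root.
have yk1 := odd_root_addr1_neq0 yk_root.
rewrite /tan_poly !rmorphM /= !hornerE map_polyX map_comp_poly horner_comp.
rewrite map_polyXn !hornerE.
have sumE : (map_poly intr (\sum_(i < k) 'X^i)).[y] = (y ^+ k - 1) / (y - 1).
  apply: (mulIf yB1); rewrite mulfVK // subrX1 mulrC rmorph_sum horner_sum.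
  by congr (_ * _); apply: eq_bigr => i _; rewrite /= map_polyXn hornerXn.
have halfE : (map_poly intr (half_geom N)).[y] = (y + 1)^-1.
  by apply: (mulfI yB1); rewrite half_geomE.
have := half_geomE yk_root; set h := _.[y ^+ k] => hE.
rewrite sumE halfE; transitivity (y / (y - 1) / (y + 1) * ((y ^+ k - 1) * h)).
  by ring.
rewrite hE; field.
rewrite yk1 y_neq0 yD1 yB1 /=.
by rewrite (_ : y * y - 1 = (y - 1) * (y + 1)) ?mulf_neq0 //; ring.
Qed.

Lemma cot_polyE {K : numFieldType} {N k k' : nat} {y : K} :
  y ^+ N.*2.+1 = 1 -> y != 1 -> (k * k' = 1 %[mod N.*2.+1])%N ->
  (map_poly intr (cot_poly N k k')).[y] = (y - y^-1) * (y ^+ k + 1) / (y ^+ k - 1).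
Proof.
move=> y_root y_neq1 kk'.
have y_neq0 := unity_root_neq0 y_root.
have ykk' : (y ^+ k) ^+ k' = y.
  by rewrite -exprM -(expr_mod _ y_root) kk' (expr_mod _ y_root).
have ykB1 : y ^+ k - 1 != 0.
  rewrite subr_eq0; apply: contraNneq y_neq1 => yk1.
  by rewrite -ykk' yk1 expr1n.
rewrite /cot_poly !rmorphM !rmorphD /= rmorph1 !map_polyXn map_polyX !hornerE.
have sumE : (map_poly intr (\sum_(i < k') 'X^(k * i))).[y] = (y - 1) / (y ^+ k - 1).
  apply: (mulIf ykB1); rewrite mulfVK // -[in RHS]ykk' [RHS]subrX1 mulrC.
  rewrite rmorph_sum horner_sum.
  by congr (_ * _); apply: eq_bigr => i _; rewrite /= map_polyXn hornerXn exprM.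
have yN : y ^+ N.*2 = y^-1.
  by apply: (mulfI y_neq0); rewrite -exprS y_root mulfV.
by rewrite sumE yN; field; rewrite ykB1 y_neq0.
Qed.

(** Both the Cayley transform [(y^k - 1) / (y^k + 1)] and [y - 1/y] change sign
    when [y] becomes [1/y]. *)
Lemma tan_poly_even {K : numFieldType} {N : nat} (k : nat) {y : K} :
  y ^+ N.*2.+1 = 1 -> y != 1 ->
  (map_poly intr (tan_poly N k)).[y^-1] = (map_poly intr (tan_poly N k)).[y].
Proof.
move=> y_root y_neq1; have y_neq0 := unity_root_neq0 y_root.
have yk_root : (y ^+ k) ^+ N.*2.+1 = 1 by rewrite exprAC y_root expr1n.
have yD1 := odd_root_addr1_neq0 y_root.
have ykD1 := odd_root_addr1_neq0 yk_root.
have yk_neq0 := unity_root_neq0 yk_root.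
rewrite !tan_polyE ?invr_eq1 ?exprVn ?y_root ?invr1 //; field.
have y2 : y * y - 1 != 0.
  by rewrite (_ : _ - 1 = (y - 1) * (y + 1)) ?mulf_neq0 ?subr_eq0 //; ring.
by rewrite y_neq0 y2 ykD1 yk_neq0 (_ : 1 + _ = - (y * y - 1)) ?oppr_eq0 ?y2 //; ring.
Qed.

Lemma cot_poly_even {K : numFieldType} {N k k' : nat} {y : K} :
  (k * k' = 1 %[mod N.*2.+1])%N -> y ^+ N.*2.+1 = 1 -> y != 1 ->
  (map_poly intr (cot_poly N k k')).[y^-1] = (map_poly intr (cot_poly N k k')).[y].
Proof.
move=> kk' y_root y_neq1; have y_neq0 := unity_root_neq0 y_root.
have yk_root : (y ^+ k) ^+ N.*2.+1 = 1 by rewrite exprAC y_root expr1n.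
have yk_neq0 := unity_root_neq0 yk_root.
have ykB1 : y ^+ k - 1 != 0.
  rewrite subr_eq0; apply: contraNneq y_neq1 => yk1.
  rewrite -(expr1 y) -(expr_mod _ y_root) -kk' (expr_mod _ y_root).
  by rewrite exprM yk1 expr1n.
rewrite !cot_polyE ?invr_eq1 ?exprVn ?y_root ?invr1 //; field.
by rewrite ykB1 y_neq0 yk_neq0 (_ : 1 + _ = - (y ^+ k - 1)) ?oppr_eq0 //; ring.
Qed.

(** * Complex exponential form *)

Local Open Scope complex_scope.

Definition cis {R : realType} (x : R) : R[i] := cos x +i* sin x.

Lemma cisD {R : realType} (x y : R) : cis (x + y) = cis x * cis y.
Proof. by rewrite /cis cosD sinD; simpc; congr (_ +i* _); ring. Qed.

Lemma cis0 {R : realType} : cis (0 : R) = 1.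
Proof. by rewrite /cis cos0 sin0. Qed.

Lemma cisX {R : realType} (x : R) m : cis x ^+ m = cis (x *+ m).
Proof. by elim: m => [|m IH]; rewrite ?cis0 // exprS IH -cisD mulrS. Qed.

Lemma cisV {R : realType} (x : R) : (cis x)^-1 = cis (- x).
Proof.
have cisM : cis (- x) * cis x = 1 by rewrite -cisD addNr cis0.
have cis_neq0 : cis x != 0.
  by apply: contra_eq_neq cisM => ->; rewrite mulr0 eq_sym oner_eq0.
by apply: (mulIf cis_neq0); rewrite cisM mulVf.
Qed.

Lemma cisB {R : realType} (x : R) : cis x - (cis x)^-1 = 'i * (2 * sin x)%:C.
Proof. by rewrite cisV /cis cosN sinN; simpc; congr (_ +i* _); ring. Qed.

(** The tangent as a Cayley transform. The hypothesis excludes the poles of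
    [tan]. *)
Lemma cis_double_tan {R : realType} (x : R) : cis (x *+ 2) + 1 != 0 ->
  (cis (x *+ 2) - 1) / (cis (x *+ 2) + 1) = 'i * (tan x)%:C.
Proof.
move=> neq0; have cos_neq0 : cos x != 0.
  apply: contra_neq neq0 => cos0.
  by rewrite /cis cos_mulr2n sin_mulr2n cos0; simpc; congr (_ +i* _); ring.
apply: (mulIf neq0); rewrite mulfVK // /cis /tan cos_mulr2n sin_mulr2n.
simpc; congr (_ +i* _); last by field.
by transitivity (- (sin x ^+ 2 *+ 2)); [rewrite sin2cos2; ring | field].
Qed.

(** If the order [m] were less than [n], then [pi m / n] would lie strictly
    between [0] and [pi], where the sine is positive; but
    [cos (2 pi m / n) = 1] forces that sine to vanish. *)
Lemma cis_prim_root {R : realType} {n : nat} : (0 < n)%N ->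
  n.-primitive_root (cis (pi *+ 2 / n%:R) : R[i]).
Proof.
move=> n_gt0; have n_neq0 : n%:R != 0 :> R by rewrite pnatr_eq0 -lt0n.
have zn1 : (cis (pi *+ 2 / n%:R) : R[i]) ^+ n = 1.
  by rewrite cisX -[_ *+ n]mulr_natr mulfVK // /cis cos2pi sin2pi.
have [m m_prim m_dvd] := prim_order_exists n_gt0 zn1.
have m_gt0 := prim_order_gt0 m_prim.
suff nm : n = m by rewrite {1}nm.
apply/eqP; rewrite eqn_leq (dvdn_leq n_gt0 m_dvd) andbT leqNgt.
apply/negP => m_lt; have := prim_expr_order m_prim.
rewrite cisX; set x : R := pi * m%:R / n%:R.
have -> : pi *+ 2 / n%:R *+ m = x *+ 2 :> R.
  by rewrite /x; field.
have x_sin : 0 < sin x.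
  apply: sin_gt0_pi; rewrite /x divr_gt0 ?mulr_gt0 ?ltr0n ?pi_gt0 //=.
  by rewrite ltr_pdivrMr ?ltr0n // ltr_pM2l ?pi_gt0 // ltr_nat.
move/(congr1 (@complex.Re R)); rewrite /= cos_mulr2n => cos1.
have := sin2cos2 x; have : 0 < sin x ^+ 2 by rewrite exprn_gt0.
by move: cos1; rewrite -mulr_natr; lra.
Qed.

Lemma prod_1B_prim_root {K : fieldType} {n : nat} {z : K} : n.+1.-primitive_root z ->
  \prod_(i < n) (1 - z ^+ i.+1) = n.+1%:R.
Proof.
move=> zP; have := factor_Xn_sub_1 zP.
rewrite big_mkord big_ord_recl expr0 subrX1 => /(mulfI (negbT (polyXsubC_eq0 1))).
move/(congr1 (horner^~ 1)); rewrite horner_prod (sum_Xn_eval1 _ id) => <-.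
by apply: eq_bigr => i _; rewrite hornerXsubC.
Qed.

(** Both sides are positive, since all the angles lie strictly between [0] and
    [pi]; so it is enough to compare squares. With [w = z ^ j], the square of the
    factor is [- (w - 1/w)^2 = (1 - w^2) (1 - w^(-2))], so that the square of the
    product is the product of [1 - (z^2)^i] over [0 < i < n], which is [n]. *)
Lemma prod_2sin {R : realType} (N : nat) :
  \prod_(j < N) (2 * sin (pi *+ 2 * j.+1%:R / N.*2.+1%:R)) = Num.sqrt N.*2.+1%:R :> R.
Proof.
set n := N.*2.+1; have n_gt0 : 0 < n%:R :> R by rewrite ltr0n.
set P := \prod_(j < N) _; have P_gt0 : 0 < P.
  apply: prodr_gt0 => j _; apply: mulr_gt0; first by rewrite ltr0n.
  have -> : pi *+ 2 * j.+1%:R = pi * (j.+1.*2)%:R :> R.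
    by rewrite -mul2n natrM; ring.
  apply: sin_gt0_pi; rewrite divr_gt0 ?mulr_gt0 ?pi_gt0 ?ltr0n //=.
  by rewrite ltr_pdivrMr // ltr_pM2l ?pi_gt0 // ltr_nat ltnS leq_double.
suff PP : P ^+ 2 = n%:R.
  by have := congr1 Num.sqrt PP; rewrite sqrtr_sqr gtr0_norm.
pose z : R[i] := cis (pi *+ 2 / n%:R).
have zP : n.-primitive_root z by exact: cis_prim_root.
have z2P : n.-primitive_root (z ^+ 2).
  by rewrite prim_root_exp_coprime // coprime2n /= odd_double.
apply: complexI; rewrite rmorphXn rmorph_prod rmorph_nat /= -(prod_1B_prim_root z2P).
have z_neq0 := unity_root_neq0 (prim_expr_order zP).
rewrite -(big_mkord predT (fun i => 1 - (z ^+ 2) ^+ i.+1)).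
rewrite (big_cat_nat (n := N)) //=; last by rewrite -addnn leq_addr.
rewrite big_mkord [X in _ = _ * X]big_rev_mkord.
rewrite (_ : N.*2 - N = N)%N; last by rewrite -addnn addnK.
rewrite expr2 -!big_split; apply: eq_bigr => j _ /=.
have -> : (N.*2 - j.+1).+1 = (n - j.+1)%N by rewrite subSn // -addnn ltn_addr.
set w := z ^+ j.+1.
have w_neq0 : w != 0 by rewrite expf_neq0.
have -> : (z ^+ 2) ^+ j.+1 = w ^+ 2 by rewrite exprAC.
(* The index range [1..2N] is folded at [N], with [i] facing [n - i]. *)
have -> : (z ^+ 2) ^+ (n - j.+1) = w ^- 2.
  rewrite exprB ?(unitfE, expf_neq0) //; last first.
    by rewrite ltnS (leq_trans (ltnW (ltn_ord j))) // -addnn leq_addr.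
  by rewrite (prim_expr_order z2P) div1r exprAC.
have wE : w - w^-1 = 'i * (2 * sin (pi *+ 2 * j.+1%:R / n%:R))%:C.
  by rewrite /w cisX cisB; congr ('i * (2 * sin _)%:C); rewrite -mulr_natr; ring.
have := congr1 (fun u => - (u * u)) wE; rewrite mulrACA.
have -> : 'i * 'i = -1 :> R[i] by rewrite -expr2 sqr_i.
rewrite mulN1r opprK => <-.
by field.
Qed.

Lemma odd_halfE {n : nat} : odd n -> n = ((n - 1) %/ 2).*2.+1.
Proof. lia. Qed.

Lemma cis_half_prim_root {R : realType} {n : nat} : odd n ->
  ((n - 1) %/ 2).*2.+1.-primitive_root (cis (pi *+ 2 / n%:R) : R[i]).
Proof. by move=> n_odd; rewrite -odd_halfE // cis_prim_root // odd_gt0. Qed.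

(** Row [j] in terms of [y = z ^ j]: the quotient of the two right-hand sides,
    in one order or the other, is the entry of the rescaled matrix, and the
    imaginary unit cancels. *)
Lemma cis_row {R : realType} {N : nat} (j k : 'I_N)
    (y := cis (pi *+ 2 / N.*2.+1%:R) ^+ j.+1 : R[i]) :
  [/\ y ^+ N.*2.+1 = 1, y != 1,
      y - y^-1 = 'i * (2 * sin (pi *+ 2 * j.+1%:R / N.*2.+1%:R))%:C
    & (y ^+ k.+1 - 1) / (y ^+ k.+1 + 1) =
        'i * (tan (pi * (j.+1 * k.+1)%:R / N.*2.+1%:R))%:C].
Proof.
have zP := @cis_prim_root R N.*2.+1 (ltn0Sn _).
have y_root : y ^+ N.*2.+1 = 1 by rewrite exprAC (prim_expr_order zP) expr1n.
have yk_root : (y ^+ k.+1) ^+ N.*2.+1 = 1 by rewrite exprAC y_root expr1n.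
have yE : y = cis (pi *+ 2 * j.+1%:R / N.*2.+1%:R).
  by rewrite /y cisX; congr cis; rewrite -[LHS]mulr_natr; ring.
split=> //.
- rewrite -(prim_order_dvd zP); apply/negP => /dvdn_leq.
  by have := ltn_ord j; lia.
- by rewrite yE cisB.
- have ykE : y ^+ k.+1 = cis (pi * (j.+1 * k.+1)%:R / N.*2.+1%:R *+ 2).
    by rewrite yE cisX; congr cis; rewrite natrM -[LHS]mulr_natr; ring.
  by have := odd_root_addr1_neq0 yk_root; rewrite ykE => /cis_double_tan.
Qed.

(** The factor [1 / sqrt n] is spread over the rows as the product of the
    [1 / (2 sin (2 pi j / n))]; dividing row [j] by its factor turns its entries
    into values of the integer polynomials [tan_poly]. *)
Lemma tan_perE {R : realType} {n : nat} : odd n ->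
  (tan_per R n)%:C = permanent (\matrix_(j < (n - 1) %/ 2, k < (n - 1) %/ 2)
    (map_poly intr (tan_poly ((n - 1) %/ 2) k.+1)).[cis (pi *+ 2 / n%:R) ^+ j.+1]).
Proof.
move=> n_odd; have nE := odd_halfE n_odd.
rewrite /tan_per /tan_mx; move: ((n - 1) %/ 2)%N nE => N ->.
rewrite -prod_2sin -prodfV -permanent_row_scale permanent_map.
congr permanent; apply/matrixP => j k; rewrite !mxE.
have [y_root y_neq1 sinE tanE] := @cis_row R N j k.
rewrite tan_polyE // sinE tanE.
by rewrite -mulf_div divff ?neq0Ci // mul1r -fmorph_div mulrC.
Qed.

(** Here [sqrt n] multiplies, so the row factor [2 sin (2 pi j / n)] cancels the
    zero that the denominator [y^k - 1] has at [y = 1]. *)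
Lemma cot_perE {R : realType} {n : nat} (inv : nat -> nat) : odd n ->
  (forall k : 'I_((n - 1) %/ 2), k.+1 * inv k.+1 = 1 %[mod n]) ->
  (cot_per R n)%:C = permanent (\matrix_(j < (n - 1) %/ 2, k < (n - 1) %/ 2)
    (map_poly intr (cot_poly ((n - 1) %/ 2) k.+1 (inv k.+1))).[
       cis (pi *+ 2 / n%:R) ^+ j.+1]).
Proof.
move=> n_odd; have nE := odd_halfE n_odd.
rewrite /cot_per /cot_mx; move: ((n - 1) %/ 2)%N nE => N -> invP.
rewrite -prod_2sin -permanent_row_scale permanent_map.
congr permanent; apply/matrixP => j k; rewrite !mxE.
have [y_root y_neq1 sinE tanE] := @cis_row R N j k.
rewrite cot_polyE // sinE -[RHS]mulrA -(invf_div (_ - 1)) tanE.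
by rewrite -[RHS]mulf_div divff ?neq0Ci // mul1r -fmorph_div.
Qed.

(** * Integrality and congruences *)

Lemma prod_ordS (R : pzSemiRingType) N : \prod_(k < N) k.+1%:R = N`!%:R :> R.
Proof. by rewrite fact_prod big_add1 big_mkord natr_prod. Qed.

Lemma eqz_mod_Fp {p : nat} {t u : int} : prime p ->
  t%:~R = u%:~R :> 'F_p -> (t = u %[mod p])%Z.
Proof.
move=> p_pr tu; apply/eqP.
by rewrite eqz_mod_dvd (dvdz_pcharf (pchar_Fp p_pr)) rmorphB /= tu subrr.
Qed.

Lemma Fp_fermat {p : nat} {x : 'F_p} : prime p -> x != 0 -> x ^+ p.-1 = 1.
Proof.
move=> p_pr x_neq0; apply: (mulfI x_neq0).
have := expf_card x; rewrite card_Fp // => xp.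
by rewrite -exprS prednK ?prime_gt0 // xp mulr1.
Qed.

(** Modulo [p = 2N + 1] the upper half [2N (2N - 1) ... (N + 1)] of [(p - 1)!] is
    [(-1)^N N!], term by term from [2N - i = - (i + 1)]; Wilson's theorem then
    reads [(-1)^N N!^2 = -1]. *)
Lemma Fp_half_fact_sqr N : prime N.*2.+1 ->
  (N`!%:R : 'F_(N.*2.+1)) ^+ 2 = (-1) ^+ N.+1.
Proof.
move=> p_pr; set p := N.*2.+1 in p_pr *; have p0 : p%:R = 0 :> 'F_p := pchar_Fp_0 p_pr.
have wilson : ((N.*2)`!%:R : 'F_p) = -1.
  apply/eqP; rewrite -addr_eq0 natr1 -(dvdn_pcharf (pchar_Fp p_pr)).
  by rewrite -(Wilson (prime_gt1 p_pr)).
have upper : ((N.*2 ^_ N)%:R : 'F_p) = (-1) ^+ N * N`!%:R.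
  rewrite ffact_prod natr_prod -prod_ordS -[X in (-1) ^+ X](card_ord N).
  rewrite -prodr_const -big_split; apply: eq_bigr => i _ /=.
  apply/eqP; rewrite mulN1r -addr_eq0 -natrD.
  rewrite (_ : (N.*2 - i + i.+1)%N = p) ?p0 //.
  by rewrite /p; have := ltn_ord i; lia.
move: wilson; rewrite -(@ffact_fact _ N) -?addnn ?leq_addr // addnK addnn natrM upper.
rewrite -mulrA -expr2 => /(congr1 ( *%R ((-1) ^+ N))).
by rewrite mulrA -exprMn mulrNN mulr1 expr1n mul1r mulrC -exprS => ->.
Qed.

(** At [X = 1] the polynomial of the permanent is [N!^2 (N + 1)^(2N)]. Since
    [N + 1] is the inverse of [2] modulo [n], its power is [1] by Fermat. *)
Lemma tan_per_int {R : realType} {n : nat} : odd n ->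
  exists2 t : int, tan_per R n = t%:~R
    & prime n -> (t = (-1) ^+ ((n + 1) %/ 2) %[mod n])%Z.
Proof.
move=> n_odd; have nE := odd_halfE n_odd.
have [t tE t_mod] := even_permanent_int (fun k : 'I__ => tan_poly _ k.+1)
  (@cis_half_prim_root R _ n_odd) (fun k y => @tan_poly_even R[i] _ k.+1 y).
exists t; first by apply: complexI; rewrite rmorph_int tan_perE.
rewrite -nE in t_mod; move=> n_pr; move/(_ n_pr): t_mod => t_mod.
have -> : ((n + 1) %/ 2 = ((n - 1) %/ 2).+1)%N by lia.
apply: (eqz_mod_Fp n_pr); move: ((n - 1) %/ 2)%N nE t t_mod {tE} => N nE t.
rewrite nE in n_pr *; rewrite (dvdz_pcharf (pchar_Fp n_pr)) rmorphB subr_eq0 => /eqP -> /=.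
rewrite (eq_bigr (fun k : 'I_N => k.+1%:R * N.+1%:R ^+ 2)) => [|k _]; last first.
  exact: tan_poly1.
rewrite big_split prod_ordS prodr_const card_ord -exprM mul2n mulrA -expr2.
rewrite rmorphM !rmorphXn rmorphN1 !rmorph_nat Fp_half_fact_sqr //.
have half_inv : (N.+1%:R : 'F_(N.*2.+1)) * 2 = 1.
  rewrite -natrM muln2 doubleS -[N.*2.+2]addn1 natrD.
  by rewrite [X in X + _](pchar_Fp_0 n_pr) add0r.
rewrite (Fp_fermat n_pr) ?mulr1 //.
by apply: contra_eq_neq half_inv => ->; rewrite mul0r eq_sym oner_eq0.
Qed.

(** At [X = 1] the polynomial of the permanent is [N!] times the product of the
    [4 k'], where [k'] is inverse to [k]; the [k'] cancel [N!] modulo [p] and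
    leave [4 ^ N = 2 ^ (p - 1)]. *)
Lemma cot_per_int {R : realType} {p : nat} : odd p -> prime p ->
  exists2 t : int, cot_per R p = t%:~R & (t = 1 %[mod p])%Z.
Proof.
move=> p_odd p_pr; have pE := odd_halfE p_odd.
(* An inverse of [k] modulo [p], by Euler's theorem. *)
pose inv k := (k ^ (totient p).-1)%N.
have invP (k : 'I_((p - 1) %/ 2)) : k.+1 * inv k.+1 = 1 %[mod p].
  rewrite -expnS prednK ?totient_gt0 ?prime_gt0 // Euler_exp_totient //.
  rewrite coprime_sym prime_coprime //; apply/negP => /dvdn_leq.
  by have := ltn_ord k; lia.
have invP' (k : 'I_((p - 1) %/ 2)) :
    k.+1 * inv k.+1 = 1 %[mod ((p - 1) %/ 2).*2.+1] by rewrite -pE invP.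
have [t tE t_mod] := even_permanent_int
  (fun k : 'I__ => cot_poly _ k.+1 (inv k.+1)) (@cis_half_prim_root R _ p_odd)
  (fun k y => @cot_poly_even R[i] _ _ _ y (invP' k)).
exists t; first by apply: complexI; rewrite rmorph_int (cot_perE inv).
rewrite -pE in t_mod; move/(_ p_pr): t_mod => t_mod.
apply: (eqz_mod_Fp p_pr); move: t_mod.
rewrite (dvdz_pcharf (pchar_Fp p_pr)) rmorphB subr_eq0 => /eqP -> /=.
rewrite -(prod_ordS int) -big_split rmorph_prod /=.
have -> : \prod_(k < (p - 1) %/ 2)
    ((k.+1%:R * (cot_poly ((p - 1) %/ 2) k.+1 (inv k.+1)).[1])%:~R : 'F_p) =
  \prod_(k < (p - 1) %/ 2) 2 ^+ 2.
  apply: eq_bigr => k _; rewrite cot_poly1 mulrCA -natrM rmorphM !rmorph_nat.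
  by rewrite -(Fp_nat_mod p_pr (_ * _)) invP Fp_nat_mod // mulr1 -natrX.
rewrite prodr_const card_ord -exprM.
have -> : (2 * ((p - 1) %/ 2) = p.-1)%N by lia.
rewrite Fp_fermat //.
rewrite -[2]/(2%:R) -(dvdn_pcharf (pchar_Fp p_pr)).
apply/negP => /(dvdn_leq (isT : 0 < 2)%N).
by rewrite leqNgt odd_prime_gt2.
Qed.

Local Close Scope complex_scope.

Theorem theorem7 (R : realType) :
  [/\ forall n : nat, odd n -> (1 < n)%N -> tan_per R n \is a Num.int,
      forall p : nat, prime p -> odd p -> cot_per R p \is a Num.int
    & forall p : nat, prime p -> odd p ->
        (exists2 t : int, tan_per R p = t%:~R
           & (t = (-1) ^+ ((p + 1) %/ 2) %[mod p])%Z) /\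
        (exists2 t' : int, cot_per R p = t'%:~R & (t' = 1 %[mod p])%Z)].
Proof.
split=> [n n_odd _|p p_pr p_odd|p p_pr p_odd].
- by have [t -> _] := @tan_per_int R n n_odd; exact: intr_int.
- by have [t -> _] := @cot_per_int R p p_odd p_pr; exact: intr_int.
- split; last exact: cot_per_int.
  by have [t tE t_mod] := @tan_per_int R p p_odd; exists t; rewrite ?t_mod.
Qed.
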